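(* For every integer $m \geq 1$ and every integer $l$ with $0 \leq l \leq m$, \[ \nu_{2}(A_{l,m}) = \nu_{2}\big((m+1-l)_{2l}\big) + l, \] where $(a)_{k} = a(a+1)\cdots(a+k-1)$ is the Pochhammer symbol (with $(a)_0=1$).
   Context: For integers $m \geq 1$ and $0 \leq l \leq m$ define \[ A_{l,m} = \frac{l!\, m!}{2^{m-l}} \sum_{k=l}^{m} 2^{k} \binom{2m-2k}{m-k}\binom{m+k}{m}\binom{k}{l}. \] These numbers are integers. For a nonzero integer $x$, $\nu_2(x)$ denotes the $2$-adic valuation of $x$, i.e. the exponent of the highest power of $2$ dividing $x$. *)

(* Defs.v *)
From mathcomp Require Import all_boot all_order all_algebra zify ring.
Import GRing.Theory Num.Theory.
Set Implicit Arguments.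
Unset Strict Implicit.
Unset Printing Implicit Defensive.

Definition pochhammer (a k : nat) : nat := \prod_(i < k) (a + i).

Definition A_numer (l m : nat) : nat :=
  l`! * m`! * \sum_(l <= k < m.+1)
    2 ^ k * 'C(2 * m - 2 * k, m - k) * 'C(m + k, m) * 'C(k, l).

(* The division is exact: see dvdn_A_numer and A_ratE below. *)
Definition A (l m : nat) : nat := A_numer l m %/ 2 ^ (m - l).

Lemma dvdn_fact2_fact (j : nat) : 2 ^ j * j`! %| (2 * j)`!.
Proof.
elim: j => [|j IHj] //.
rewrite (_ : 2 * j.+1 = (2 * j).+2); last by lia.
rewrite !factS expnS.
rewrite (_ : 2 * 2 ^ j * (j.+1 * j`!) = (2 * j).+2 * (2 ^ j * j`!)); last by nia.
by rewrite dvdn_mul // dvdn_mull.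
Qed.

Lemma dvdn_A_term (l m k : nat) : l <= k <= m ->
  2 ^ m %| l`! * m`! * ('C(2 * m - 2 * k, m - k) * 'C(m + k, m) * 'C(k, l)).
Proof.
move=> /andP[lk km]; set j := m - k.
have -> : 2 * m - 2 * k = 2 * j by rewrite /j; lia.
have [c Hc] : exists c, 'C(2 * j, j) * j`! = c * 2 ^ j.
  have /dvdnP[c Hc] := dvdn_fact2_fact j; exists c.
  have := @bin_fact (2 * j) j; rewrite (_ : 2 * j - j = j); last by lia.
  move=> /(_ _) Hb; apply/eqP; rewrite -(eqn_pmul2r (fact_gt0 j)).
  by rewrite -!mulnA -Hc Hb //; lia.
have /dvdnP[d Hd] := dvdn_fact2_fact k.
have H1 : 'C(m + k, m) * (m`! * k`!) = (m + k)`!.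
  by have := @bin_fact (m + k) m (leq_addr _ _); rewrite addKn.
have H2 : 'C(m + k, j) * (j`! * (2 * k)`!) = (m + k)`!.
  rewrite -(@bin_fact (m + k) j); last by rewrite /j; lia.
  by congr (_ * (_ * _`!)); rewrite /j; lia.
have H3 : m`! * 'C(m + k, m) = 'C(m + k, j) * j`! * d * 2 ^ k.
  apply/eqP; rewrite -(eqn_pmul2r (fact_gt0 k)); apply/eqP.
  by rewrite (mulnC m`!) -mulnA H1 -H2 Hd !mulnA.
have -> : l`! * m`! * ('C(2 * j, j) * 'C(m + k, m) * 'C(k, l)) =
    l`! * 'C(k, l) * 'C(2 * j, j) * (m`! * 'C(m + k, m)) by ring.
rewrite H3.
have -> : l`! * 'C(k, l) * 'C(2 * j, j) * ('C(m + k, j) * j`! * d * 2 ^ k) =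
    l`! * 'C(k, l) * 'C(m + k, j) * d * ('C(2 * j, j) * j`!) * 2 ^ k by ring.
rewrite Hc -!mulnA -expnD (_ : j + k = m); last by rewrite /j; lia.
by rewrite !mulnA dvdn_mull.
Qed.

Lemma dvdn_A_numer (l m : nat) : 2 ^ (m - l) %| A_numer l m.
Proof.
rewrite /A_numer big_distrr /= big_seq.
apply: dvdn_sum => k; rewrite mem_index_iota ltnS => /dvdn_A_term H.
apply: (@dvdn_trans (2 ^ m)); first by rewrite dvdn_exp2l // leq_subr.
rewrite -!(mulnA (2 ^ k)) (mulnCA _ (2 ^ k)).
exact: dvdn_mull.
Qed.

Lemma A_gt0 (l m : nat) : l <= m -> 0 < A l m.
Proof.
move=> lm; rewrite divn_gt0 ?expn_gt0 //; apply: dvdn_leq; last exact: dvdn_A_numer.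
rewrite /A_numer !muln_gt0 !fact_gt0 /= big_nat_recr //= !subnn bin0.
by rewrite addn_gt0 !muln_gt0 expn_gt0 !bin_gt0 leq_addr lm orbT.
Qed.

Lemma A_ratE (l m : nat) :
  ((A l m)%:R = (l`!)%:R * (m`!)%:R / 2%:R ^+ (m - l) *
    \sum_(l <= k < m.+1) 2%:R ^+ k * ('C(2 * m - 2 * k, m - k))%:R *
      ('C(m + k, m))%:R * ('C(k, l))%:R :> rat)%R.
Proof.
have nz : (2%:R ^+ (m - l) != 0 :> rat)%R by rewrite expf_neq0.
have hA : A l m * 2 ^ (m - l) = A_numer l m by rewrite divnK ?dvdn_A_numer.
apply: (mulIf nz); rewrite -{1}natrX -[LHS]natrM hA mulrAC divfK //.
rewrite /A_numer !natrM natr_sum; congr (_ * _)%R.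
by apply: eq_bigr => k _; rewrite !natrM natrX.
Qed.

(* Main.v *)
Require Import Defs.
From mathcomp Require Import all_boot all_algebra.
From mathcomp Require Import zify ring.

Set Implicit Arguments.
Unset Strict Implicit.
Unset Printing Implicit Defensive.

Import GRing.Theory Num.Theory.

(** Put t_k = 2^k C(2m-2k,m-k) C(m+k,m) and S_j = \sum_k t_k C(k,j), so that
    2^(m-l) A_{l,m} = l! m! S_l. The weights satisfy the first-order recurrence
      (2(m-k)-1)(k+1) t_{k+1} = (m-k)(m+k+1) t_k,
    from which creative telescoping extracts
      (m-j)(m+j+1) S_j + (j+1)(j+2) S_{j+2} = (2m+1)(j+1) S_{j+1}.
    After normalization this says A_{l,m} = c_{m-l} 2^l (m+1-l)_{2l}, where
      c_0 = 1,   c_{d+1} = (2m+1) c_d - d (2m+1-d) c_{d-1}.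
    One of d and 2m+1-d is even, so every integer c_d is odd. *)

Section BinomialMoment.

Local Open Scope ring_scope.

Variable R : comPzRingType.
Implicit Types (t : nat -> R) (x : R) (n j k : nat).

Definition binomial_moment t n j : R := \sum_(k < n.+1) t k * 'C(k, j)%:R.

Lemma binomial_moment_small t n j : (n < j)%N -> binomial_moment t n j = 0.
Proof.
move=> lt_nj; rewrite /binomial_moment big1 // => k _.
by rewrite bin_small ?mulr0 // (leq_trans (ltn_ord k)).
Qed.

Lemma binomial_moment_diag t n : binomial_moment t n n = t n.
Proof.
rewrite /binomial_moment big_ord_recr /= binn mulr1 big1 ?add0r // => k _.
by rewrite bin_small ?mulr0.
Qed.

Lemma natr_mul_bin_left k j :
  j.+1%:R * 'C(k, j.+1)%:R = (k%:R - j%:R) * 'C(k, j)%:R :> R.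
Proof.
have [lt_kj | le_jk] := ltnP k j; first by rewrite !bin_small ?mulr0 // ltnW.
by rewrite -natrB // -!natrM mul_bin_left.
Qed.

Lemma natr_mul_bin_diag k j :
  k.+1%:R * 'C(k, j)%:R = j.+1%:R * 'C(k.+1, j.+1)%:R :> R.
Proof. by rewrite -!natrM (mul_bin_diag k.+1). Qed.

Lemma bin_kernel_rec x k j :
  (x - j%:R) * (x + j.+1%:R) * 'C(k, j)%:R + j.+1%:R * j.+2%:R * 'C(k, j.+2)%:R
    - (2 * x + 1) * j.+1%:R * 'C(k, j.+1)%:R =
  (x - k%:R) * (x + k.+1%:R) * 'C(k, j)%:R
    - (2 * (x - k%:R) + 1) * j.+1%:R * 'C(k, j.+1)%:R.
Proof.
have bin_addn2 : j.+1%:R * j.+2%:R * 'C(k, j.+2)%:R =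
    (k%:R - j.+1%:R) * (j.+1%:R * 'C(k, j.+1)%:R) :> R.
  by rewrite -mulrA natr_mul_bin_left; ring.
by rewrite bin_addn2 -!(mulrA _ j.+1%:R) natr_mul_bin_left; ring.
Qed.

Lemma binomial_moment_rec t x n j :
    (forall k, (k < n)%N ->
      (2 * (x - k%:R) - 1) * k.+1%:R * t k.+1 =
      (x - k%:R) * (x + k.+1%:R) * t k) ->
  (x - j%:R) * (x + j.+1%:R) * binomial_moment t n j
    + j.+1%:R * j.+2%:R * binomial_moment t n j.+2
    - (2 * x + 1) * j.+1%:R * binomial_moment t n j.+1 =
  (x - n%:R) * (x + n.+1%:R) * t n * 'C(n, j)%:R.
Proof.
move=> t_rec.
pose summand k := t k * ((x - k%:R) * (x + k.+1%:R) * 'C(k, j)%:R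
    - (2 * (x - k%:R) + 1) * j.+1%:R * 'C(k, j.+1)%:R).
pose primitive k := (2 * (x - k%:R) + 1) * t k * (j.+1%:R * 'C(k, j.+1)%:R).
have summandE k : (k < n)%N -> summand k = primitive k.+1 - primitive k.
  move=> lt_kn; rewrite /primitive -natr_mul_bin_diag.
  have -> : (2 * (x - k.+1%:R) + 1) * t k.+1 * (k.+1%:R * 'C(k, j)%:R) =
      (2 * (x - k%:R) - 1) * k.+1%:R * t k.+1 * 'C(k, j)%:R by ring.
  by rewrite t_rec // /summand; ring.
transitivity (\sum_(0 <= k < n.+1) summand k).
  rewrite big_mkord /binomial_moment !mulr_sumr -big_split -sumrB /=.
  by apply: eq_bigr => k _; rewrite /summand -bin_kernel_rec; ring.
rewrite big_nat_recr //= (telescope_sumr_eq primitive) //.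
by rewrite /summand /primitive bin0n /=; ring.
Qed.

End BinomialMoment.

Definition A_weight (m k : nat) : nat :=
  2 ^ k * 'C(2 * m - 2 * k, m - k) * 'C(m + k, m).

Lemma mul_central_binS n :
  n.+1 * 'C(2 * n.+1, n.+1) = 2 * (2 * n).+1 * 'C(2 * n, n).
Proof.
have -> : 2 * n.+1 = (2 * n).+2 by lia.
rewrite -(mul_bin_diag (2 * n).+2) -mulnA (mul_bin_down (2 * n).+1).
by rewrite (_ : (2 * n).+1 - n = n.+1); [ring | lia].
Qed.

Lemma mul_bin_addS m k : k.+1 * 'C(m + k.+1, m) = (m + k).+1 * 'C(m + k, m).
Proof. by rewrite addnS (mul_bin_down (m + k).+1) subSn ?leq_addr // addKn. Qed.

Lemma A_weightS k d :
  (2 * d).+1 * k.+1 * A_weight (k + d.+1) k.+1 =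
  d.+1 * (k + d.+1 + k).+1 * A_weight (k + d.+1) k.
Proof.
rewrite /A_weight -!mulnBr addKn -addSnnS addKn addSnnS; set m := k + d.+1.
transitivity
  (2 ^ k * (2 * (2 * d).+1 * 'C(2 * d, d)) * (k.+1 * 'C(m + k.+1, m))).
  by rewrite expnS; ring.
by rewrite mul_bin_addS -mul_central_binS; ring.
Qed.

Section CofactorRecurrence.

Local Open Scope ring_scope.
Implicit Types (m l d k : nat).

Definition A_moment m l : int :=
  binomial_moment (fun k => (A_weight m k)%:R) m l.

Lemma A_moment_rec m j :
  (m%:R - j%:R) * (m%:R + j.+1%:R) * A_moment m j
    + j.+1%:R * j.+2%:R * A_moment m j.+2 =
  (2 * m%:R + 1) * j.+1%:R * A_moment m j.+1.
Proof.
apply/eqP; rewrite -subr_eq0 binomial_moment_rec ?subrr ?mul0r // => k lt_km.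
have [d ->] : exists d, m = (k + d.+1)%N by exists (m - k.+1)%N; lia.
have := congr1 (fun n => n%:R : int) (A_weightS k d).
rewrite /= !natrM => weightS.
have -> : 2 * ((k + d.+1)%:R - k%:R) - 1 = (2 * d).+1%:R :> int by ring.
by rewrite weightS; ring.
Qed.

Lemma A_numer_moment m l : (A_numer l m)%:R = (l`! * m`!)%:R * A_moment m l.
Proof.
rewrite /A_numer natrM natr_sum big_geq_mkord big_mkcond; congr (_ * _).
apply: eq_bigr => k _; rewrite -natrM andTb; case: leqP => // lt_kl.
by rewrite bin_small ?muln0.
Qed.

(* At d = 0 the coefficient of the junk term A_cofactor m 0.-1 vanishes. *)
Fixpoint A_cofactor m d : int :=
  if d is d'.+1 then
    (2 * m%:R + 1) * A_cofactor m d'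
      - d'%:R * (2 * m%:R + 1 - d'%:R) * A_cofactor m d'.-1
  else 1.

Lemma A_cofactorS m d : A_cofactor m d.+1 =
  (2 * m%:R + 1) * A_cofactor m d
    - d%:R * (2 * m%:R + 1 - d%:R) * A_cofactor m d.-1.
Proof. by []. Qed.

Lemma dvd2_mul_subr_odd m d : (2 %| (d%:R * (2 * m%:R + 1 - d%:R))%R)%Z.
Proof.
rewrite -[d]odd_double_half; case: (odd d); rewrite -muln2 /=.
  by apply/dvdzP; exists ((1 + d./2 * 2)%:R * (m%:R - d./2%:R)); ring.
by apply/dvdzP; exists (d./2%:R * (2 * m%:R + 1 - (d./2 * 2)%:R)); ring.
Qed.

Lemma A_cofactor_odd m d : odd `|A_cofactor m d|.
Proof.
suff : ~~ (2 %| A_cofactor m d)%Z by rewrite dvdzE dvdn2 negbK.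
elim: d => [|d IHd] //.
have even_step := dvdz_mulr (A_cofactor m d.-1) (dvd2_mul_subr_odd m d).
by rewrite A_cofactorS rpredBr // mulrDl mul1r rpredDl // -mulrA dvdz_mulr.
Qed.

Lemma A_moment_fact_rec m l d : (l + d.+1 = m)%N ->
  (m + l).+1%:R * ((l`! * m`! * d.+1`!)%:R * A_moment m l) =
  (2 * m%:R + 1) * ((l.+1`! * m`! * d`!)%:R * A_moment m l.+1)
    - (l.+2`! * m`! * d`!)%:R * A_moment m l.+2.
Proof.
move=> def_m; apply/eqP; rewrite eq_sym subr_eq; apply/eqP.
transitivity ((l`! * m`! * d`!)%:R *
    ((2 * m%:R + 1) * l.+1%:R * A_moment m l.+1)).
  by rewrite !factS; ring.
by rewrite -A_moment_rec -def_m !factS; ring.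
Qed.

Lemma A_moment_cofactor m l d : (l + d = m)%N ->
  (l`! * m`! * d`!)%:R * A_moment m l = A_cofactor m d * (2 ^ m * (m + l)`!)%:R.
Proof.
elim/ltn_ind: d l => -[|d] IHd l def_m.
  rewrite -def_m addn0 /A_moment binomial_moment_diag.
  rewrite /A_weight !subnn bin0 mul1r.
  by rewrite -natrM -(bin_fact (leq_addr l l)) addKn fact0; congr _%:R; ring.
have moment_l1 := IHd d (ltnSn d) l.+1 (etrans (addSnnS l d) def_m).
have moment_l2 : (l.+2`! * m`! * d`!)%:R * A_moment m l.+2 =
    d%:R * A_cofactor m d.-1 * (2 ^ m * (m + l.+2)`!)%:R.
  case: d IHd def_m {moment_l1} => [|d] IHd def_m.
    by rewrite /A_moment binomial_moment_small ?mulr0 ?mul0r //; lia.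
  by rewrite -[RHS]mulrA -(IHd d _ l.+2) ?factS; [ring | lia | lia].
have coef_neq0 : (m + l).+1%:R != 0 :> int by rewrite pnatr_eq0.
apply: (mulfI coef_neq0).
rewrite A_moment_fact_rec // moment_l1 moment_l2 A_cofactorS.
by rewrite !addnS !factS -def_m; ring.
Qed.

End CofactorRecurrence.

Lemma A_numer_factorization m l : l <= m ->
  A_numer l m * (m - l)`! = `|A_cofactor m (m - l)| * (2 ^ m * (m + l)`!).
Proof.
move=> le_lm; have := congr1 absz (A_moment_cofactor (subnKC le_lm)).
by rewrite natrM mulrAC -A_numer_moment -natrM !natz abszM !absz_nat.
Qed.

Lemma pochhammer_fact a n : pochhammer a.+1 n * a`! = (a + n)`!.
Proof.
rewrite (fact_split (leq_addr n a)) mulnC -[in RHS](add0n a.+1) big_addn.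
rewrite subSS addKn big_mkord; congr (_ * _).
by apply: eq_bigr => i _; rewrite addnC.
Qed.

Lemma A_factorization m l : l <= m ->
  A l m = `|A_cofactor m (m - l)| * (pochhammer (m + 1 - l) (2 * l) * 2 ^ l).
Proof.
move=> le_lm; have denom_gt0 : 0 < 2 ^ (m - l) * (m - l)`!.
  by rewrite muln_gt0 expn_gt0 fact_gt0.
apply/eqP; rewrite -(eqn_pmul2r denom_gt0); apply/eqP.
rewrite mulnA divnK ?dvdn_A_numer // A_numer_factorization //.
have -> : m + l = m - l + 2 * l by lia.
have -> : 2 ^ m = 2 ^ l * 2 ^ (m - l) by rewrite -expnD subnKC.
by rewrite -pochhammer_fact addn1 subSn //; ring.
Qed.

Theorem theorem1p1 (m l : nat) (hm : 1 <= m) (hl : l <= m) :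
  logn 2 (A l m) = logn 2 (pochhammer (m + 1 - l) (2 * l)) + l.
Proof.
have pochhammer_gt0 : 0 < pochhammer (m + 1 - l) (2 * l).
  by apply: prodn_gt0 => i; lia.
rewrite A_factorization // logn_Gauss ?coprime2n ?A_cofactor_odd //.
by rewrite lognM ?expn_gt0 // pfactorK.
Qed.
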